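(* Let $\{\kappa_\theta:\theta\in\Theta\}$ be a canonical non-negative power series (NNPS) family of laws on $\{0,1,2,\dots\}$, let $K\sim\kappa_\theta$ with probability generating function $\psi_\theta(t)=\mathbb{E}\,t^K$, and assume $\{0,1\}\subset \mathrm{supp}(K)$. Let $\nu$ be a diffuse (i.e. non-atomic) probability measure on a measurable space $(E,\mathcal{E})$, and let $N=(\kappa_\theta,\nu)$ be the random counting measure on $(E,\mathcal{E})$ obtained by the stone throwing construction. Then the following are equivalent. (i) For any $A\in\mathcal{E}$ with $a=\nu(A)>0$ there exists a mapping $h_a:\Theta\to\Theta$ (depending on $A$ only through $a$) such that, for every $\theta\in\Theta$, the restricted random measure is $N_A=(\kappa_{h_a(\theta)},\nu_A)$, that is, $$\mathbb{E}\,e^{-N_Af}=\psi_{h_a(\theta)}\big(\nu_A e^{-f}\big)\qquad\text{for all } f\in\mathcal{E}_+ .$$ (ii) $K$ is Poisson, negative binomial or binomial.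
   Context: Canonical NNPS family: there are coefficients $a_k\ge 0$ ($k\ge 0$) with $a_0=1$, and $g(\theta)=\sum_{k\ge0}a_k\theta^k$ with radius of convergence $R\in(0,\infty]$; $\Theta=(0,R)$ and $\kappa_\theta(\{k\})=p_k(\theta)=a_k\theta^k/g(\theta)$ for $k\ge0$. The condition $\{0,1\}\subset\mathrm{supp}(K)$ means $p_0(\theta)>0$ and $p_1(\theta)>0$, i.e. $a_1>0$. Stone throwing construction (STC): for a law $\kappa$ on $\{0,1,2,\dots\}$ with finite mean and a probability measure $\nu$ on $(E,\mathcal{E})$, $N=(\kappa,\nu)$ denotes the random counting measure $N(B)=\sum_{i=1}^{K}\mathbb{I}_B(X_i)$, $B\in\mathcal{E}$, where $K\sim\kappa$, the $X_1,X_2,\dots$ are iid with law $\nu$, and $K$ is independent of $(X_i)$. For $f\in\mathcal{E}_+$ (the non-negative $\mathcal{E}$-measurable functions), $Nf=\sum_{i=1}^K f(X_i)$; for a measure $\mu$, $\mu f=\int f\,d\mu$. For $A\in\mathcal{E}$ with $\nu(A)>0$: $\nu_A(B)=\nu(A\cap B)/\nu(A)$, and $N_A$ is the restriction of $N$ to $A$, $N_A(B)=N(A\cap B)$, with $N_Af=\sum_{i=1}^K \mathbb{I}_A(X_i)f(X_i)$; its total count is $K_A=N(A)$. Non-atomic: every measurable set of positive $\nu$-measure contains a measurable subset of strictly smaller positive $\nu$-measure. In (ii), $K$ being of a given type refers to the family $\{\kappa_\theta\}_{\theta\in\Theta}$: every $\kappa_\theta$ is a Poisson law; or, for some fixed real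 $r>0$, every $\kappa_\theta$ is a negative binomial law $\kappa(\{k\})=\binom{r+k-1}{k}(1-p)^r p^k$ with $p\in(0,1)$ depending on $\theta$; or, for some fixed integer $n\ge1$, every $\kappa_\theta$ is a binomial law with parameters $n$ and some $p\in(0,1)$ depending on $\theta$. *)

(* Defs.v *)
From HB Require Import structures.
From mathcomp Require Import all_boot all_order all_algebra.
From mathcomp Require Import all_classical all_reals all_analysis.
From mathcomp Require Import measurable_realfun.

Set Implicit Arguments.
Unset Strict Implicit.
Unset Printing Implicit Defensive.

Import Order.TTheory GRing.Theory Num.Theory.
Import numFieldNormedType.Exports.

Local Open Scope classical_set_scope.
Local Open Scope ring_scope.

Section nnps.
Context {R : realType}.
Implicit Types (a : nat -> R) (t : R) (k : nat).

Definition convergence_radius a : \bar R :=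
  ereal_sup [set `|x|%:E | x in [set x | cvgn (pseries a x)]].

Definition canonical_nnps a : Prop :=
  [/\ a 0%N = 1, forall k, 0 <= a k & (0 < convergence_radius a)%E].

Definition nnps_gen a t : R := limn (pseries a t).

Definition nnps_param a : set R :=
  [set t | 0 < t /\ (t%:E < convergence_radius a)%E].

Definition nnps_pmf a t k : R := a k * t ^+ k / nnps_gen a t.

Definition pmf_support (kappa : nat -> R) : set nat := [set k | 0 < kappa k].

(* The product over k`! is the generalised binomial coefficient
   binom(r + k - 1, k) for real r. *)
Definition negative_binomial_pmf (r p : R) k : R :=
  (\prod_(i < k) (r + i%:R)) / k`!%:R * (1 - p) `^ r * p ^+ k.

Implicit Types (T : set R) (kappa : R -> nat -> R).

Definition poisson_family T kappa : Prop :=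
  forall t, T t -> exists2 rate, 0 < rate & kappa t = poisson_pmf rate.

(* The shape parameter r (resp. n, below) is common to the whole family; only p
   varies with t. *)
Definition negative_binomial_family T kappa : Prop :=
  exists2 r, 0 < r & forall t, T t ->
    exists2 p, 0 < p < 1 & kappa t = negative_binomial_pmf r p.

Definition binomial_family T kappa : Prop :=
  exists2 n, (1 <= n)%N & forall t, T t ->
    exists2 p, 0 < p < 1 & kappa t = binomial_pmf n p.

End nnps.

Section measures.
Context {d} {E : measurableType d} {R : realType}.

Definition nonatomic (nu : {measure set E -> \bar R}) : Prop :=
  forall A, measurable A -> (0 < nu A)%E ->
    exists B, [/\ measurable B, B `<=` A & (0 < nu B < nu A)%E].

(* nu_A; the default value nu of mnormalize is only used when nu A = 0. *)
Definition cond_prob (nu : probability E R) (A : set E) (mA : measurable A) :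
    probability E R :=
  mnormalize (mrestr nu mA) nu.

Lemma cond_probE (nu : probability E R) (A : set E) (mA : measurable A) B :
  (0 < nu A)%E -> cond_prob nu mA B = (nu (A `&` B) * (fine (nu A))^-1%:E)%E.
Proof.
move=> A0; rewrite /cond_prob/= /mnormalize/= /mrestr setTI.
have Aoo : (nu A < +oo)%E by rewrite -ge0_fin_numE // fin_num_measure.
by rewrite gt_eqF// lt_eqF//= setIC.
Qed.

End measures.

Section stone_throwing.
Context {d dO} {E : measurableType d} {Om : measurableType dO} {R : realType}.
Implicit Types (P : probability Om R) (nu : probability E R).

Definition mutually_independent P (X : nat -> Om -> E) : Prop :=
  forall (J : seq nat) (B : nat -> set E),
    uniq J -> (forall i, measurable (B i)) ->
    P (\bigcap_(i in [set` J]) X i @^-1` B i) =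
      (\prod_(i <- J) P (X i @^-1` B i))%E.

Definition generated_sigma_algebra (X : nat -> Om -> E) : set (set Om) :=
  <<s [set D | exists i, exists2 B, measurable B & D = X i @^-1` B] >>.

Definition independent_of_sequence P (K : Om -> nat) (X : nat -> Om -> E) :
    Prop :=
  forall (C : set nat) (D : set Om), generated_sigma_algebra X D ->
    P (K @^-1` C `&` D) = (P (K @^-1` C) * P D)%E.

(* The stones are indexed from 0. *)
Definition stone_throwing (kappa : nat -> R) nu P
    (K : {RV P >-> nat}) (X : nat -> {RV P >-> E}) : Prop :=
  [/\ forall k, P (K @^-1` [set k]) = (kappa k)%:E,
      ('E_P[fun w => (K w)%:R] < +oo)%E,
      forall i B, measurable B -> P (X i @^-1` B) = nu B,
      mutually_independent P X &
      independent_of_sequence P K X].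

Definition stone_measure (K : Om -> nat) (X : nat -> Om -> E) (w : Om) :
    {measure set E -> \bar R} :=
  msum (fun i => \d_(X i w)) (K w).

Definition pgf P (K : Om -> nat) (s : R) : \bar R :=
  'E_P[fun w => s ^+ K w].

Lemma Rintegral_stone_measure (K : Om -> nat) (X : nat -> Om -> E) (w : Om)
    (A : set E) (mA : measurable A) (f : E -> R) :
  measurable_fun setT f -> (forall x, 0 <= f x) ->
  \int[mrestr (stone_measure K X w) mA]_x f x =
    \sum_(i < K w) \1_A (X i w) * f (X i w).
Proof.
move=> mf f0.
have mfE : measurable_fun setT (EFin \o f) by exact/measurable_EFinP.
have ind_ge0 x : (0 : R) <= \1_A x by rewrite indicE.
pose c i : {nonneg R} := NngNum (ind_ge0 (X i w)).
have -> : \int[mrestr (stone_measure K X w) mA]_x f x =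
    \int[msum (fun i => mscale (c i) \d_(X i w)) (K w)]_x f x.
  congr fine; apply: eq_measure_integral => B mB _.
  rewrite /= /mrestr /= /msum /=; apply: eq_bigr => i _.
  rewrite /mscale /= !diracE !indicE in_setI.
  by case: (_ \in B); case: (_ \in A); rewrite ?mule1 ?mule0.
rewrite /Rintegral ge0_integral_measure_sum//; last first.
  by move=> x _; rewrite lee_fin.
rewrite (eq_bigr (fun i : 'I_(K w) => (\1_A (X i w) * f (X i w))%:E)).
  by rewrite sumEFin.
move=> i _; rewrite ge0_integral_mscale//; last by move=> x _; rewrite lee_fin.
by rewrite integral_dirac// diracT mul1e.
Qed.

End stone_throwing.

(* Main.v *)
Require Import Defs.
From HB Require Import structures.
From mathcomp Require Import all_boot all_order all_algebra.
From mathcomp Require Import all_classical all_reals all_analysis.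
From mathcomp Require Import measurable_realfun.
From mathcomp Require Import ring lra.

Set Implicit Arguments.
Unset Strict Implicit.
Unset Printing Implicit Defensive.

Import Order.TTheory GRing.Theory Num.Theory.
Import numFieldNormedType.Exports.

Local Open Scope classical_set_scope.
Local Open Scope ring_scope.

(** Write g for the generating function sum_k a_k x^k and b for a_1.

    Probability enters only through the Laplace functional of a stone throwing
    measure: conditioning on K = k, the k stones contribute independent factors
    of common mean m = nu y, so E prod_(i < K) y(X_i) = sum_k kappa_k m^k
    ([stone_throwing_pgf]), which is g(t m) / g(t) for the member t of the
    family.  Keeping only the stones in A means taking
    y = exp(- 1_A f), whose mean is 1 - alpha + alpha s with alpha = nu A and
    s = nu_A e^{-f}.  So stability under restriction says
    exactly that for every t there is h with
      g(t (1 - alpha + alpha s)) / g(t) = g(h s) / g(h),        (thinning)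
    for all s in ]0, 1] and all positive values alpha of nu.

    The bridge to the three families is the recursion [panjer]
      (k + 1) a_(k+1) = b (1 + gam k) a_k,
    which is the same as the linear differential equation
      (1 - gam b x) g'(x) = b g(x)                              (ode)
    ([panjer_ode], [ode_panjer]).

    From (thinning) to the recursion ([thinning_panjer]): differentiating twice
    in s and letting s tend to 0 eliminates h, and leaves
      g(u) g''(u) b^2 = 2 a_2 g'(u)^2   at u = t (1 - alpha).
    As t varies in the parameter set, u fills a whole right neighbourhood of 0,
    so that a single set with 0 < nu A < 1 is enough.  This says that g / g' is
    affine near 0, which is (ode).

    From the recursion to (thinning) ([panjer_thinning]): with
    h = t alpha / (1 - gam b t (1 - alpha)) both sides, as functions of s, solve
    the same first order linear equation.  That 1 - gam b x > 0 on the parameter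
    set, hence that h is well defined and h <= t, is free from (ode) since g and
    g' are positive.

    Finally the recursion with gam = 0, gam > 0, gam < 0 is Poisson, negative
    binomial with r = 1 / gam, and binomial with n = - 1 / gam
    ([panjer_families], [families_panjer]); in the last case n is an integer
    because the first nonpositive factor 1 + gam k follows a positive a_k and so
    must vanish. *)

(** * The Laplace functional of a stone throwing measure *)

Section indicator_extension.
Local Open Scope ereal_scope.
Context {d d'} {T : measurableType d} {E : measurableType d'} {R : realType}.
Import HBNNSimple.

(** If the mu-integral of W 1_B(X) is c nu(B) for every B, then the image under
    X of the measure of density W is c nu; this is the resulting change of
    variables, for nonnegative y, by approximation with simple functions. *)
Lemma ge0_integral_indic_extend (mu : {measure set T -> \bar R})
    (nu : {measure set E -> \bar R}) (c : R) (W : T -> R) (X : T -> E) (y : E -> R) :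
  (0 <= c)%R -> measurable_fun setT W -> (forall w, 0 <= W w)%R ->
  measurable_fun setT X ->
  (forall B, measurable B ->
     \int[mu]_w (W w * \1_B (X w))%:E = c%:E * nu B) ->
  measurable_fun setT y -> (forall x, 0 <= y x)%R ->
  \int[mu]_w (W w * y (X w))%:E = c%:E * \int[nu]_x (y x)%:E.
Proof.
move=> c0 mW W0 mX WB my y0.
have myE : measurable_fun setT (EFin \o y) by exact/measurable_EFinP.
pose f := nnsfun_approx measurableT myE.
have f_cvg x : EFin \o f ^~ x @ \oo --> (y x)%:E.
  by apply: (cvg_nnsfun_approx measurableT myE) => // t _; rewrite lee_fin.
have f_nd x a b : (a <= b)%N -> (f a x <= f b x)%R.
  by move=> ab; exact/lefP/nd_nnsfun_approx.
have mWf (g : E -> R) : measurable_fun setT g ->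
    measurable_fun setT (fun w => (W w * g (X w))%:E).
  by move=> mg; apply/measurable_EFinP/measurable_funM => //; exact: measurableT_comp.
have simple n : \int[mu]_w (W w * f n (X w))%:E = c%:E * \int[nu]_x (f n x)%:E.
  pose F r := f n @^-1` [set r].
  have mFr r : measurable (F r) by exact: measurable_sfunP.
  have m1 r : measurable_fun setT (\1_(F r) : E -> R) by exact: measurable_indic.
  have mF r : measurable_fun setT (fun x => (r * \1_(F r) x)%R).
    exact: measurable_funM.
  transitivity (\int[mu]_w \sum_(r \in range (f n)) (W w * (r * \1_(F r) (X w)))%:E).
    apply: eq_integral => w _.
    rewrite EFinM fimfunE -fsumEFin// ge0_mule_fsumr// => r.
    by rewrite EFinM nnfun_muleindic_ge0.
  rewrite ge0_integral_fsum//; last 2 first.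
  - by move=> r; exact: (mWf _ (mF r)).
  - by move=> r w _; rewrite EFinM mule_ge0//; [rewrite lee_fin|rewrite EFinM nnfun_muleindic_ge0].
  transitivity (\sum_(r \in range (f n)) c%:E * \int[nu]_x (r * \1_(F r) x)%:E).
    apply: eq_fsbigr => r /[!inE] -[x _ <-].
    under eq_integral do rewrite mulrCA EFinM.
    rewrite ge0_integralZl//; [|exact: (mWf _ (m1 _))|
      by move=> w _; rewrite lee_fin mulr_ge0|by rewrite lee_fin].
    rewrite WB//; under [in RHS]eq_integral do rewrite EFinM.
    rewrite ge0_integralZl//; [|exact/measurable_EFinP|by rewrite lee_fin].
    by rewrite integral_indic// setIT muleCA.
  rewrite -ge0_mule_fsumr; last first.
    by move=> r; apply: integral_ge0 => x _; rewrite EFinM nnfun_muleindic_ge0.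
  rewrite -ge0_integral_fsum//; last 2 first.
  - by move=> r; exact/measurable_EFinP.
  - by move=> r x _; rewrite EFinM nnfun_muleindic_ge0.
  by congr (_ * _); apply: eq_integral => x _; rewrite fsumEFin// -fimfunE.
transitivity (limn (fun n => \int[mu]_w (W w * f n (X w))%:E)).
  rewrite -monotone_convergence//.
  - apply: eq_integral => w _; apply/esym/cvg_lim => //.
    under eq_fun do rewrite EFinM.
    by rewrite EFinM; apply: cvgeZl => //; exact: f_cvg.
  - by move=> n; exact: mWf.
  - by move=> n w _; rewrite lee_fin mulr_ge0.
  - by move=> w _ a b ab; rewrite lee_fin ler_wpM2l// f_nd.
under eq_fun do rewrite simple.
apply/cvg_lim => //; apply: cvgeZl => //.
rewrite (_ : \int[nu]_x _ = \int[nu]_x limn (fun n => (f n x)%:E)); last first.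
  by apply: eq_integral => x _; apply/esym/cvg_lim => //; exact: f_cvg.
apply: cvg_monotone_convergence => //.
- by move=> n; exact/measurable_EFinP.
- by move=> n x _; rewrite lee_fin.
- by move=> x _ a b ab; rewrite lee_fin f_nd.
Qed.

End indicator_extension.

Section laplace_functional.
Context {d dO} {E : measurableType d} {Om : measurableType dO} {R : realType}.
Variables (kappa : nat -> R) (nu : probability E R) (P : probability Om R).
Variables (K : {RV P >-> nat}) (X : nat -> {RV P >-> E}).
Hypothesis stc : stone_throwing kappa nu K X.

Let nu_fin B : measurable B -> nu B = (fine (nu B))%:E.
Proof. by move=> mB; rewrite fineK// fin_num_measure. Qed.

Let mX i : measurable_fun setT (X i).
Proof. exact: measurable_funP. Qed.

Let mXB i B : measurable B -> measurable (X i @^-1` B).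
Proof. by move=> mB; rewrite -[X in measurable X]setTI; exact: mX. Qed.

Let mK k : measurable (K @^-1` [set k]).
Proof. by rewrite -[X in measurable X]setTI; exact: measurable_funP. Qed.

Lemma stone_law_ge0 k : 0 <= kappa k.
Proof. by case: stc => Pk _ _ _ _; rewrite -lee_fin -Pk. Qed.

Lemma stone_throwing_cylinder k (J : seq nat) (B : nat -> set E) :
  uniq J -> (forall i, measurable (B i)) ->
  P (K @^-1` [set k] `&` \bigcap_(i in [set` J]) X i @^-1` B i) =
    (kappa k * \prod_(i <- J) fine (nu (B i)))%:E.
Proof.
case: stc => Kk _ Xnu Xind KX uJ mB.
rewrite KX; last first.
  pose G := [set D | exists i, exists2 B, measurable B & D = X i @^-1` B].
  apply: (@fin_bigcap_measurable _ (g_sigma_algebraType G)) => // i _.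
  by apply: sub_sigma_algebra; exists i; exists (B i).
rewrite Xind// Kk EFinM; congr (_ * _)%E.
rewrite -prodEFin; apply: eq_bigr => i _.
by rewrite -nu_fin// Xnu.
Qed.

Lemma prodr_indic_preimage (J : seq nat) (B : nat -> set E) w :
  \prod_(i <- J) \1_(B i) (X i w) =
  \1_(\bigcap_(i in [set` J]) X i @^-1` B i) w :> R.
Proof.
rewrite bigcap_seq; elim: J => [|j J IH].
  by rewrite !big_nil indicE in_setT.
by rewrite !big_cons IH indicI.
Qed.

(** Independence is only given on events.  It passes to integrals by replacing
    the indicators 1_(B i)(X i) by y(X i) one at a time, from the left: at
    each step the previous one, with B j arbitrary, is the hypothesis of
    [ge0_integral_indic_extend]. *)
Lemma stone_throwing_product (y : E -> R) (m : R) k j n (B : nat -> set E) :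
  measurable_fun setT y -> (forall x, 0 <= y x) ->
  (\int[nu]_x (y x)%:E = m%:E)%E ->
  (j <= n)%N -> (forall i, measurable (B i)) ->
  (\int[P]_w (\1_(K @^-1` [set k]) w * \prod_(0 <= i < j) y (X i w)
             * \prod_(j <= i < n) \1_(B i) (X i w))%:E =
  (kappa k * m ^+ j * \prod_(j <= i < n) fine (nu (B i)))%:E)%E.
Proof.
move=> my y0 ym; have m0 : 0 <= m.
  by rewrite -lee_fin -ym; apply: integral_ge0 => x _; rewrite lee_fin.
elim: j B => [|j IH] B jn mB.
  under eq_integral do rewrite big_geq// mulr1 prodr_indic_preimage.
  pose D := \bigcap_(i in [set` index_iota 0 n]) X i @^-1` B i.
  have mD : measurable D by apply: fin_bigcap_measurable => // i _; exact: mXB.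
  transitivity (\int[P]_w (\1_(K @^-1` [set k] `&` D) w)%:E)%E.
    by apply: eq_integral => w _; rewrite indicI.
  rewrite integral_indic ?setIT//; last exact: measurableI.
  by rewrite expr0 mulr1; apply: stone_throwing_cylinder => //; exact: iota_uniq.
pose W w := \1_(K @^-1` [set k]) w * \prod_(0 <= i < j) y (X i w)
             * \prod_(j.+1 <= i < n) \1_(B i) (X i w).
pose c := kappa k * m ^+ j * \prod_(j.+1 <= i < n) fine (nu (B i)).
have mW : measurable_fun setT W.
  apply: measurable_funM; [apply: measurable_funM|].
  - exact: measurable_indic.
  - by apply: measurable_prod => i _; exact: measurableT_comp.
  - by apply: measurable_prod => i _; apply: measurableT_comp => //; exact: measurable_indic.
transitivity (\int[P]_w (W w * y (X j w))%:E)%E.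
  apply: eq_integral => w _; congr EFin; rewrite /W big_nat_recr//=; ring.
transitivity (c%:E * \int[nu]_x (y x)%:E)%E; last first.
  by rewrite ym -EFinM /c exprS; congr EFin; ring.
apply: ge0_integral_indic_extend => //.
- rewrite /c mulr_ge0//; last by apply: prodr_ge0 => i _; exact: fine_ge0.
  by rewrite mulr_ge0 ?exprn_ge0//; exact: stone_law_ge0.
- move=> w; rewrite !mulr_ge0//; first by apply: prodr_ge0.
  by apply: prodr_ge0.
move=> C mC.
transitivity (c * fine (nu C))%:E; last by rewrite EFinM -nu_fin.
pose B' i := if i == j then C else B i.
have mB' i : measurable (B' i) by rewrite /B'; case: ifP.
have B'jj : B' j = C by rewrite /B' eqxx.
have B'j i : (j < i)%N -> B' i = B i by rewrite /B' => /gtn_eqF ->.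
transitivity (\int[P]_w (\1_(K @^-1` [set k]) w * \prod_(0 <= i < j) y (X i w)
             * \prod_(j <= i < n) \1_(B' i) (X i w))%:E)%E.
  apply: eq_integral => w _; congr EFin; rewrite /W (big_ltn jn).
  rewrite B'jj.
  rewrite [\prod_(j.+1 <= i < n) \1_(B' i) _](eq_big_nat _ _
    (F2 := fun i => \1_(B i) (X i w))); last by move=> i /andP[/B'j ->].
  ring.
rewrite IH// 1?ltnW//; congr EFin; rewrite /c (big_ltn jn) B'jj.
rewrite [\prod_(j.+1 <= i < n) fine (nu (B' i))](eq_big_nat _ _
  (F2 := fun i => fine (nu (B i)))); last by move=> i /andP[/B'j ->].
ring.
Qed.

(** The law of total expectation over the events K = k, on each of which the
    product is that of k independent variables of mean m. *)
Lemma stone_throwing_pgf (y : E -> R) (m : R) :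
  measurable_fun setT y -> (forall x, 0 <= y x) ->
  (\int[nu]_x (y x)%:E = m%:E)%E ->
  ('E_P[fun w => (\prod_(i < K w) y (X i w))%R] =
     \sum_(0 <= k <oo) (kappa k * m ^+ k)%:E)%E.
Proof.
move=> my y0 ym; rewrite unlock.
pose F k := K @^-1` [set k].
have FT : \bigcup_k F k = setT.
  by apply/seteqP; split=> // w _; exists (K w).
pose f w := \prod_(i < K w) y (X i w).
have fF k w : w \in F k -> f w = \prod_(0 <= i < k) y (X i w).
  by rewrite inE /f /F /= => ->; rewrite big_mkord.
rewrite -[X in integral _ X _]FT ge0_integral_bigcup//.
- apply: eq_eseriesr => k _.
  rewrite integral_mkcond.
  (* the case j = n = k, where no indicator is left *)
  transitivity (kappa k * m ^+ k * \prod_(k <= i < k) fine (nu setT))%:E; last first.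
    by rewrite (big_geq (leqnn k)) mulr1.
  rewrite -(stone_throwing_product k my y0 ym (leqnn k) (B := fun=> setT))//.
  apply: eq_integral => w _; rewrite (big_geq (leqnn k)) mulr1 patchE indicE.
  rewrite -/(F k); case: ifPn => [wF|_]; last by rewrite mul0r.
  by rewrite mul1r -fF.
- apply/measurable_fun_bigcup => // k.
  apply: (eq_measurable_fun (fun w => (\prod_(0 <= i < k) y (X i w))%:E)).
    by move=> w wF; rewrite -fF.
  apply/measurable_EFinP; apply: measurable_prod => i _.
  by apply: measurable_funTS; exact: measurableT_comp.
- by move=> w _; rewrite lee_fin; apply: prodr_ge0.
- apply/trivIsetP => i j _ _ ij; apply/seteqP; split=> // w [Ki Kj].
  by move: ij; rewrite -Ki -Kj eqxx.
Qed.

End laplace_functional.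

(** * One-variable calculus *)

Section calculus.
Context {R : realType}.
Implicit Types (f k : R -> R) (x y u v : R).

Lemma is_derive1_cvg f x v : is_derive x 1 f v -> {for x, continuous f}.
Proof.
by move=> df; apply/differentiable_continuous/derivable1_diffP.
Qed.

Lemma is_derive1_mul f k x u v : is_derive x 1 f u -> is_derive x 1 k v ->
  is_derive x 1 (fun z => f z * k z) (u * k x + f x * v).
Proof.
move=> df dk; apply: is_derive_eq; rewrite /GRing.scale/=; ring.
Qed.

Lemma is_derive1_affine c0 c1 x : is_derive x 1 (fun z : R => c0 + c1 * z) c1.
Proof.
apply: is_derive_eq; rewrite /GRing.scale/=; ring.
Qed.

Lemma is_derive1_comp_affine f c0 c1 x u : is_derive (c0 + c1 * x) 1 f u ->
  is_derive x 1 (fun z => f (c0 + c1 * z)) (c1 * u).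
Proof.
move=> df; rewrite mulrC.
exact: (@is_derive1_comp _ f (fun z => c0 + c1 * z) _ _ _ df (is_derive1_affine _ _ _)).
Qed.

Lemma is_derive1_div f k x u v : k x != 0 -> is_derive x 1 f u ->
  is_derive x 1 k v ->
  is_derive x 1 (fun z => f z / k z) ((u * k x - f x * v) / k x ^+ 2).
Proof.
move=> kx df dk.
apply: (is_derive_eq (is_derive1_mul df (is_deriveV kx dk))).
by rewrite /GRing.scale/=; field.
Qed.

Lemma derive0_eq f x y : x <= y ->
  (forall z, x <= z <= y -> is_derive z 1 f 0) -> f x = f y.
Proof.
move=> xy df; have [| |c _] := @MVT_segment _ f (fun=> 0) x y xy.
- by move=> z; rewrite in_itv/= => /andP[xz zy]; apply: df; rewrite !ltW.
- apply: continuous_in_subspaceT => z; rewrite inE/= in_itv/= => zxy.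
  exact: is_derive1_cvg (df z zxy).
- by rewrite mul0r => /eqP; rewrite subr_eq0 => /eqP.
Qed.

(** A vanishing Wronskian makes f / k constant.  This is how two solutions of one
    first order linear equation are compared: where the leading coefficient
    does not vanish, both have the same logarithmic derivative. *)
Lemma wronskian0_eq f k (f' k' : R -> R) x y : x <= y ->
  (forall z, x <= z <= y -> k z != 0) ->
  (forall z, x <= z <= y -> is_derive z 1 f (f' z)) ->
  (forall z, x <= z <= y -> is_derive z 1 k (k' z)) ->
  (forall z, x <= z <= y -> f' z * k z = f z * k' z) ->
  f x * k y = f y * k x.
Proof.
move=> xy k0 df dk W0.
have kx : k x != 0 by apply: k0; rewrite lexx.
have ky : k y != 0 by apply: k0; rewrite lexx andbT.
suff : f x / k x = f y / k y.
  by move/eqP; rewrite eqr_div// => /eqP.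
apply: (@derive0_eq (fun z => f z / k z)) => // z zxy.
have := is_derive1_div (k0 z zxy) (df z zxy) (dk z zxy).
by rewrite W0// subrr mul0r.
Qed.

(** Identities on ]0, r[ pass to the endpoint 0 by continuity and to derivatives
    by locality; applied repeatedly, this yields the Taylor coefficients at 0. *)
Lemma eq_itv0_derive f k (f' k' : R -> R) (r : R) : 0 < r ->
  (forall s, 0 <= s < r -> is_derive s 1 f (f' s)) ->
  (forall s, 0 <= s < r -> is_derive s 1 k (k' s)) ->
  (forall s, 0 < s < r -> f s = k s) ->
  f 0 = k 0 /\ (forall s, 0 < s < r -> f' s = k' s).
Proof.
move=> r0 df dk fk; split.
  have f0 : f s @[s --> 0^'+] --> f 0.
    by apply: cvg_at_right_filter; apply: (is_derive1_cvg (df 0 _)); rewrite lexx.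
  have k0 : k s @[s --> 0^'+] --> k 0.
    by apply: cvg_at_right_filter; apply: (is_derive1_cvg (dk 0 _)); rewrite lexx.
  apply: (@cvg_unique _ _ (f s @[s --> 0^'+])) => //.
  apply: cvg_trans k0; apply: near_eq_cvg; near=> s.
  by rewrite fk//; apply/andP; split; near: s; [exact: nbhs_right_gt|exact: nbhs_right_lt].
move=> s /andP[s0 sr].
have dfs : is_derive s 1 f (f' s) by apply: df; rewrite ltW.
have dks : is_derive s 1 k (k' s) by apply: dk; rewrite ltW.
have : is_derive s 1 k (f' s).
  apply: near_eq_is_derive dfs; near=> z; apply: fk.
  by near: z; apply: near_in_itvoo; rewrite in_itv/= s0.
by move=> dkf; rewrite -(@derive_val _ _ _ _ _ _ _ dkf) (@derive_val _ _ _ _ _ _ _ dks).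
Unshelve. all: by end_near. Qed.

End calculus.

(** * Power series on a disc *)

Section power_series.
Context {R : realType}.
Implicit Types (c : nat -> R) (r x z : R).

(** Convergence on an open disc rather than at a point: with this form, passing
    to the termwise derivative costs nothing in the radius. *)
Definition cvg_disc c r := forall z, `|z| < r -> cvgn (pseries c z).

(** The mean value inequality for the power n + 1, which dominates the terms of
    the derived series at r by those of the original series at s > r. *)
Lemma diffs_term_bound r s n : 0 <= r <= s ->
  n.+1%:R * r ^+ n * (s - r) <= s ^+ n.+1 - r ^+ n.+1.
Proof.
move=> /andP[r0 rs]; have s0 : 0 <= s := le_trans r0 rs.
elim: n => [|n IH]; first by rewrite expr0 !expr1 mulr1 mul1r.
have -> : s ^+ n.+2 - r ^+ n.+2 =
    s * (s ^+ n.+1 - r ^+ n.+1) + r ^+ n.+1 * (s - r) by rewrite !exprS; ring.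
have -> : n.+2%:R * r ^+ n.+1 * (s - r) =
    r * (n.+1%:R * r ^+ n * (s - r)) + r ^+ n.+1 * (s - r).
  by rewrite -[n.+2%:R]natr1 exprS; ring.
rewrite lerD2r (le_trans (ler_wpM2l r0 IH))// ler_wpM2r// subr_ge0.
by rewrite lerXn2r// nnegrE.
Qed.

Lemma cvg_disc_diffs c r : cvg_disc c r -> cvg_disc (pseries_diffs c) r.
Proof.
move=> cr z zr.
pose s := (`|z| + r) / 2; pose s' := (s + r) / 2.
have zs : `|z| < s by rewrite /s; lra.
have s0 : 0 < s := le_lt_trans (normr_ge0 _) zs.
have ss' : s < s' by rewrite /s' /s; lra.
have s'r : s' < r by rewrite /s' /s; lra.
have cs : cvgn (pseries (fun i => `|c i|) s).
  apply: (@is_cvg_pseries_inside_norm _ _ s').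
    by apply: cr; rewrite gtr0_norm// (lt_trans s0).
  by rewrite !gtr0_norm// (lt_trans s0).
apply: normed_cvg.
have sz0 : 0 < s - `|z| by rewrite subr_gt0.
have cs1 : cvgn (series (fun n => (s - `|z|)^-1 * (`|c n.+1| * s ^+ n.+1))).
  apply: is_cvg_seriesZ.
  rewrite (_ : series _ = (fun n => pseries (fun i => `|c i|) s n.+1 - `|c 0%N|)).
    case/cvg_ex: cs => l csl; apply: (@cvgP _ _ (l - `|c 0%N|)).
    by apply: cvgB; [rewrite cvg_shiftS|exact: cvg_cst].
  apply/funext => n; rewrite /pseries /series/= big_nat_recl//= expr0 mulr1.
  by rewrite addrAC subrr add0r.
apply: series_le_cvg cs1 => n /=; first exact: normr_ge0.
  by rewrite !mulr_ge0 ?invr_ge0 ?exprn_ge0//; exact: ltW.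
rewrite /pseries_diffs !normrM normr_nat normrX [leRHS]mulrC ler_pdivlMr//.
rewrite (_ : _ * _ * _ * _ = `|c n.+1| * (n.+1%:R * `|z| ^+ n * (s - `|z|))); last by ring.
rewrite ler_wpM2l// (le_trans (diffs_term_bound _ _))//.
  by rewrite normr_ge0 ltW.
by rewrite gerBl exprn_ge0.
Qed.

Lemma is_derive_nnps_gen c r x : cvg_disc c r -> `|x| < r ->
  is_derive x 1 (nnps_gen c) (nnps_gen (pseries_diffs c) x).
Proof.
move=> cr xr; pose s := (`|x| + r) / 2.
have xs : `|x| < s by rewrite /s; lra.
have sr : `|s| < r by rewrite gtr0_norm; [rewrite /s; lra|exact: le_lt_trans xs].
apply: (@pseries_snd_diffs _ _ s).
- exact: cr.
- exact: cvg_disc_diffs sr.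
- exact: (cvg_disc_diffs (cvg_disc_diffs cr)) sr.
- by rewrite (lt_le_trans xs)// ler_norm.
Qed.

Lemma nnps_gen_at0 c : nnps_gen c 0 = c 0%N.
Proof.
apply: cvg_lim => //; rewrite -cvg_shiftS.
rewrite (_ : (fun n => _) = fun=> c 0%N); first exact: cvg_cst.
apply/funext => n; rewrite /pseries /series/= big_nat_recl//= big1 ?addr0 ?expr0 ?mulr1//.
by move=> i _; rewrite exprS mul0r mulr0.
Qed.

Lemma nnps_gen_ge_coef0 c x : (forall k, 0 <= c k) -> 0 <= x ->
  cvgn (pseries c x) -> c 0%N <= nnps_gen c x.
Proof.
move=> c0 x0 cx.
have -> : c 0%N = pseries c x 1 by rewrite /pseries /series/= big_nat1 expr0 mulr1.
apply: (nondecreasing_cvgn_le _ cx).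
by apply: nondecreasing_series => n _ _; rewrite mulr_ge0 ?exprn_ge0.
Qed.

(** Vanishing on a right neighbourhood of 0 is inherited by the derivative, and
    the value at 0 is the constant coefficient. *)
Lemma nnps_gen_eq0_coef c r n : 0 < r -> cvg_disc c r ->
  (forall x, 0 < x < r -> nnps_gen c x = 0) -> c n = 0.
Proof.
move=> r0; elim: n c => [|n IH] c cr gc0;
  have [c0 dc0] : nnps_gen c 0 = 0 /\
      (forall x, 0 < x < r -> nnps_gen (pseries_diffs c) x = 0)
    by apply: (@eq_itv0_derive _ (nnps_gen c) (fun=> 0) (nnps_gen (pseries_diffs c))
         (fun=> 0) r) => // x /andP[x0 xr]; apply: is_derive_nnps_gen cr _;
       rewrite ger0_norm.
  by rewrite -nnps_gen_at0.
have /eqP := IH _ (cvg_disc_diffs cr) dc0.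
by rewrite mulf_eq0 pnatr_eq0/= => /eqP.
Qed.

End power_series.

(** * The recursion behind the three families *)

Section panjer.
Context {R : realType}.
Variable a : nat -> R.
Hypothesis a_nnps : canonical_nnps a.
Hypothesis a1_gt0 : 0 < a 1%N.

Let a0 : a 0%N = 1. Proof. by case: a_nnps. Qed.
Let a_ge0 k : 0 <= a k. Proof. by case: a_nnps. Qed.

Local Notation g := (nnps_gen a).
Local Notation g' := (nnps_gen (pseries_diffs a)).

(** Panjer's recursion, also known as the (a, b, 0) class, for unnormalised
    weights; the factor a_1 is forced by the case k = 0 when a_0 = 1. *)
Definition panjer (gam : R) :=
  forall k, k.+1%:R * a k.+1 = a 1%N * (1 + gam * k%:R) * a k.

Lemma nnps_param_disc t : nnps_param a t -> exists2 r, t < r & cvg_disc a r.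
Proof.
move=> [t0 /ereal_sup_gt[_ [x cx <-]]]; rewrite lte_fin => tx.
by exists `|x| => // z; exact: is_cvg_pseries_inside.
Qed.

Lemma nnps_param_le t x : nnps_param a t -> 0 < x <= t -> nnps_param a x.
Proof.
move=> [t0 tr] /andP[x0 xt]; split=> //.
by rewrite (le_lt_trans _ tr)// lee_fin.
Qed.

Lemma nnps_param_nonempty : exists t, nnps_param a t.
Proof.
case: a_nnps => _ _ /ereal_sup_gt[_ [x cx <-]]; rewrite lte_fin => x0.
exists (`|x| / 2); split; first by rewrite divr_gt0.
apply: (@lt_le_trans _ _ `|x|%:E); first by rewrite lte_fin; lra.
by apply: ereal_sup_ubound; exists x.
Qed.

Lemma nnps_gen_ge1 r x : cvg_disc a r -> 0 <= x < r -> 1 <= g x.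
Proof.
move=> ar /andP[x0 xr]; rewrite -a0; apply: nnps_gen_ge_coef0 => //.
by apply: ar; rewrite ger0_norm.
Qed.

Lemma nnps_gen_diffs_gt0 r x : cvg_disc a r -> 0 <= x < r -> 0 < g' x.
Proof.
move=> ar /andP[x0 xr].
rewrite (lt_le_trans a1_gt0)// -[leLHS]mul1r.
apply: (@nnps_gen_ge_coef0 _ (pseries_diffs a)) => //.
  by move=> k; rewrite mulr_ge0.
by apply: (cvg_disc_diffs ar); rewrite ger0_norm.
Qed.

Let defect gam k := k.+1%:R * a k.+1 - a 1%N * (1 + gam * k%:R) * a k.

(** The failures of the recursion are the coefficients of the failure of the
    differential equation. *)
Lemma defect_gen gam r x : cvg_disc a r -> `|x| < r ->
  pseries (defect gam) x @ \oo --> (1 - gam * a 1%N * x) * g' x - a 1%N * g x.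
Proof.
move=> ar xr.
have c1 : cvgn (pseries (pseries_diffs a) x) by exact: (cvg_disc_diffs ar).
have c2 := pseries_diffs_equiv c1.
rewrite (_ : pseries (defect gam) x = (fun n =>
    pseries (pseries_diffs a) x n
    - gam * a 1%N * x * series (fun i => i%:R * a i * x ^+ i.-1) n
    - a 1%N * pseries a x n)).
  rewrite mulrBl mul1r; apply: cvgB; last by apply: cvgMr; exact: ar.
  by apply: cvgB => //; exact: cvgMr.
apply/funext => n; rewrite /pseries /series/= !mulr_sumr -!sumrB.
apply: eq_bigr => -[|i] _; rewrite /defect /pseries_diffs.
  by rewrite !expr0; ring.
by rewrite [x ^+ i.+1]exprS; ring.
Qed.

Lemma panjer_ode gam r x : panjer gam -> cvg_disc a r -> `|x| < r ->
  (1 - gam * a 1%N * x) * g' x = a 1%N * g x.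
Proof.
move=> pa ar xr; apply/eqP; rewrite -subr_eq0; apply/eqP.
rewrite -(cvg_lim _ (defect_gen (gam := gam) ar xr))//.
rewrite (_ : pseries _ _ = fun=> 0) ?lim_cst//; apply/funext => n.
by rewrite /pseries /series/= big1// => k _; rewrite /defect pa subrr mul0r.
Qed.

Lemma ode_panjer gam r : 0 < r -> cvg_disc a r ->
  (forall x, 0 < x < r -> (1 - gam * a 1%N * x) * g' x = a 1%N * g x) ->
  panjer gam.
Proof.
move=> r0 ar ode k; apply/eqP; rewrite -subr_eq0; apply/eqP.
apply: (@nnps_gen_eq0_coef _ (defect gam) r) => // [z zr|x /andP[x0 xr]].
  by apply: cvgP (defect_gen ar zr).
have xr' : `|x| < r by rewrite gtr0_norm.
by rewrite /nnps_gen (cvg_lim _ (defect_gen ar xr'))// ode ?x0// subrr.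
Qed.

(** The equation itself gives the sign, since g and g' are positive. *)
Lemma panjer_coef_gt0 gam r x : panjer gam -> cvg_disc a r -> 0 <= x < r ->
  0 < 1 - gam * a 1%N * x.
Proof.
move=> pa ar xr; have xr' : `|x| < r by case/andP: xr => x0 ?; rewrite ger0_norm.
rewrite -(pmulr_lgt0 _ (nnps_gen_diffs_gt0 ar xr)) (panjer_ode pa ar xr') mulr_gt0//.
exact: lt_le_trans (nnps_gen_ge1 ar xr).
Qed.

(** Closed forms of g are identified by the differential equation instead of by
    summing the series. *)
Lemma panjer_gen_unique gam t (F F' : R -> R) : panjer gam -> nnps_param a t ->
  F 0 = 1 -> (forall x, 0 <= x <= t -> F x != 0) ->
  (forall x, 0 <= x <= t -> is_derive x 1 F (F' x)) ->
  (forall x, 0 <= x <= t -> (1 - gam * a 1%N * x) * F' x = a 1%N * F x) ->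
  g t = F t.
Proof.
move=> pa tT F0 Fn0 dF odeF; have t0 : 0 <= t by case: tT => /ltW.
have [r tr ar] := nnps_param_disc tT.
have inr x : 0 <= x <= t -> 0 <= x < r.
  by move=> /andP[-> xt]; exact: le_lt_trans tr.
have inr' x : 0 <= x <= t -> `|x| < r.
  by move=> /inr/andP[x0 ?]; rewrite ger0_norm.
have := @wronskian0_eq _ g F g' F' 0 t t0 Fn0.
rewrite nnps_gen_at0 a0 F0 mul1r mulr1 => W; apply/esym/W => //.
  by move=> x /inr' xr; apply: (is_derive_nnps_gen ar).
move=> x xt; have D0 := panjer_coef_gt0 pa ar (inr _ xt).
apply: (mulfI (lt0r_neq0 D0)).
rewrite mulrA (panjer_ode pa ar (inr' _ xt)) [RHS]mulrCA odeF//; ring.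
Qed.

(** With D = 1 - gam b t (1 - al) and h = t al / D, the leading coefficients of
    the equations satisfied by the two sides match up to the factor D:
    1 - gam b v = D (1 - gam b h s) at v = t (1 - al) + t al s. *)
Lemma panjer_thinning gam : panjer gam -> forall al, 0 < al <= 1 ->
  exists2 h : R -> R, (forall t, nnps_param a t -> nnps_param a (h t)) &
  forall t s, nnps_param a t -> 0 <= s <= 1 ->
    g (t * (1 - al + al * s)) / g t = g (h t * s) / g (h t).
Proof.
move=> pa al /andP[al0 al1].
pose D t := 1 - gam * a 1%N * (t * (1 - al)).
have D_gt0 t : nnps_param a t -> 0 < D t.
  move=> tT; have [r tr ar] := nnps_param_disc tT; have [t0 _] := tT.
  apply: (panjer_coef_gt0 pa ar); apply/andP; split.
    by rewrite mulr_ge0 ?subr_ge0// ltW.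
  by rewrite (le_lt_trans _ tr)// ler_piMr ?gerBl// ltW.
have h_le t : nnps_param a t -> 0 < t * al / D t <= t.
  move=> tT; have [r tr ar] := nnps_param_disc tT; have [t0 _] := tT.
  have : 0 < 1 - gam * a 1%N * t by apply: (panjer_coef_gt0 pa ar); rewrite ltW.
  have D0 := D_gt0 t tT; rewrite divr_gt0 ?mulr_gt0//= ler_pdivrMr//.
  by rewrite ler_pM2l// /D; nra.
exists (fun t => t * al / D t) => [t tT|t s tT s01].
  by apply: (nnps_param_le tT); exact: h_le.
have [r tr ar] := nnps_param_disc tT; have [t0 _] := tT.
have D0 := D_gt0 t tT; have /andP[h0 ht] := h_le t tT.
set h := t * al / D t in h0 ht *.
have inv z : 0 <= z <= 1 -> 0 <= t * (1 - al) + t * al * z < r.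
  move=> /andP[z0 z1]; rewrite -mulrA -mulrDr; apply/andP; split.
    by apply: mulr_ge0; [exact: ltW|nra].
  by rewrite (le_lt_trans _ tr)// ler_piMr ?(ltW t0)//; nra.
have inh z : 0 <= z <= 1 -> 0 <= 0 + h * z < r.
  move=> /andP[z0 z1]; rewrite add0r mulr_ge0// ?(ltW h0)//=.
  by rewrite (le_lt_trans _ tr)// (le_trans _ ht)// ler_piMr// ltW.
have inD z : 0 <= z < r -> `|z| < r by move=> /andP[? ?]; rewrite ger0_norm.
have g_gt0 z : 0 <= z < r -> 0 < g z.
  by move=> /(nnps_gen_ge1 ar); exact: lt_le_trans.
have := @wronskian0_eq _ (fun z => g (t * (1 - al) + t * al * z))
  (fun z => g (0 + h * z)) (fun z => t * al * g' (t * (1 - al) + t * al * z))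
  (fun z => h * g' (0 + h * z)) s 1.
have -> : t * (1 - al) + t * al * s = t * (1 - al + al * s) by ring.
have -> : t * (1 - al) + t * al * 1 = t by ring.
rewrite mulr1 !add0r => W.
have in01 z : s <= z <= 1 -> 0 <= z <= 1.
  by move=> /andP[sz ->]; rewrite andbT (le_trans _ sz)//; case/andP: s01.
have gt0 : g t != 0 by rewrite gt_eqF// g_gt0// tr ltW.
have gh0 : g h != 0 by rewrite gt_eqF// g_gt0// (ltW h0)/= (le_lt_trans ht).
apply/eqP; rewrite eqr_div//.
apply/eqP; rewrite [RHS]mulrC; apply: W => [|z|z|z|z]; first by case/andP: s01.
- by move=> z01; rewrite gt_eqF// g_gt0// inh// in01.
- by move=> z01; apply: is_derive1_comp_affine; apply: (is_derive_nnps_gen ar); apply/inD/inv/in01.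
- by move=> z01; apply: is_derive1_comp_affine; apply: (is_derive_nnps_gen ar); apply/inD/inh/in01.
move=> z01; have zz := in01 z z01.
have odev := panjer_ode pa ar (inD _ (inv z zz)).
have odeh := panjer_ode pa ar (inD _ (inh z zz)).
have v0 := panjer_coef_gt0 pa ar (inv z zz).
move: odev odeh v0; set v := _ + t * al * z; set u := 0 + h * z => odev odeh v0.
apply: (mulfI (lt0r_neq0 v0)).
rewrite [LHS](_ : _ = t * al * ((1 - gam * a 1%N * v) * g' v) * g u); last by ring.
have vu : 1 - gam * a 1%N * v = D t * (1 - gam * a 1%N * u).
  by rewrite /u /v /h /D; field; rewrite gt_eqF.
rewrite odev vu.
rewrite [RHS](_ : _ = (D t * h) * g v * ((1 - gam * a 1%N * u) * g' u)); last by ring.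
by rewrite odeh mulrC /h; field; rewrite gt_eqF.
Qed.

End panjer.

(** * Thinning forces the recursion *)

Section thinning_to_panjer.
Context {R : realType}.
Variable a : nat -> R.
Hypothesis a_nnps : canonical_nnps a.
Hypothesis a1_gt0 : 0 < a 1%N.

Local Notation g := (nnps_gen a).
Local Notation g' := (nnps_gen (pseries_diffs a)).
Local Notation g'' := (nnps_gen (pseries_diffs (pseries_diffs a))).

Variables (al : R) (h : R -> R).
Hypothesis al01 : 0 < al < 1.
Hypothesis hT : forall t, nnps_param a t -> nnps_param a (h t).
Hypothesis thinning : forall t s, nnps_param a t -> 0 < s < 1 ->
  g (t * (1 - al + al * s)) / g t = g (h t * s) / g (h t).

(** The value and the first two derivatives of the thinning identity at s = 0 read
    C g(u) = 1, C (t al) g'(u) = h a_1 and C (t al)^2 g''(u) = 2 h^2 a_2, where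
    C = g(h) / g(t); the quantity g g'' / g'^2 is free of C and h. *)
Lemma thinning_ode2 t : nnps_param a t -> let u := t * (1 - al) in
  g u * g'' u * a 1%N ^+ 2 = 2 * a 2%N * g' u ^+ 2.
Proof.
move=> tT u; have hT' := hT tT.
have [r tr ar] := nnps_param_disc tT; have [r' hr ar'] := nnps_param_disc hT'.
have [t0 _] := tT; have [h0 _] := hT'; have /andP[al0 al1] := al01.
have gt0 : 0 < g t by rewrite (lt_le_trans _ (nnps_gen_ge1 a_nnps ar _))// tr ltW.
have gh0 : 0 < g (h t) by rewrite (lt_le_trans _ (nnps_gen_ge1 a_nnps ar' _))// hr ltW.
pose C := g (h t) / g t; have C0 : 0 < C by rewrite divr_gt0.
(* the zero puts w in the affine form expected by [is_derive1_comp_affine] *)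
pose v s := u + t * al * s; pose w s := 0 + h t * s.
have inv (s : R) : 0 <= s < 1 -> `|v s| < r.
  move=> /andP[s0 s1]; rewrite /v /u -mulrA -mulrDr normrM gtr0_norm//.
  rewrite ger0_norm; last by rewrite addr_ge0 ?mulr_ge0 ?subr_ge0// ltW.
  by rewrite (le_lt_trans _ tr)// ler_piMr ?(ltW t0)//; nra.
have inw (s : R) : 0 <= s < 1 -> `|w s| < r'.
  move=> /andP[s0 s1]; rewrite /w add0r ger0_norm; last by rewrite mulr_ge0// ltW.
  by rewrite (le_lt_trans _ hr)// ler_piMr// ltW.
have dv c (s : R) : cvg_disc c r -> 0 <= s < 1 -> is_derive s 1
    (fun s => nnps_gen c (v s)) (t * al * nnps_gen (pseries_diffs c) (v s)).
  move=> cr /inv vr.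
  have dc := @is_derive1_comp_affine _ (nnps_gen c) u (t * al) s.
  exact (dc _ (is_derive_nnps_gen cr vr)).
have dw c (s : R) : cvg_disc c r' -> 0 <= s < 1 -> is_derive s 1
    (fun s => nnps_gen c (w s)) (h t * nnps_gen (pseries_diffs c) (w s)).
  move=> cr /inw vr.
  have dc := @is_derive1_comp_affine _ (nnps_gen c) 0 (h t) s.
  exact (dc _ (is_derive_nnps_gen cr vr)).
have step c c1 c2 : cvg_disc c r -> cvg_disc c r' ->
   (forall s : R, 0 < s < 1 -> c1 * nnps_gen c (v s) = c2 * nnps_gen c (w s)) ->
   c1 * nnps_gen c u = c2 * c 0%N /\
   (forall s : R, 0 < s < 1 -> c1 * (t * al) * nnps_gen (pseries_diffs c) (v s) =
      c2 * h t * nnps_gen (pseries_diffs c) (w s)).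
  move=> cr cr' eqc.
  have dl (s : R) : 0 <= s < 1 -> is_derive s 1 (fun s => c1 * nnps_gen c (v s))
      (c1 * (t * al * nnps_gen (pseries_diffs c) (v s))).
    move=> s01; have dc := is_derive1_mul (is_derive_cst c1 s 1) (dv c s cr s01).
    by apply: (is_derive_eq dc); rewrite mul0r add0r.
  have dr (s : R) : 0 <= s < 1 -> is_derive s 1 (fun s => c2 * nnps_gen c (w s))
      (c2 * (h t * nnps_gen (pseries_diffs c) (w s))).
    move=> s01; have dc := is_derive1_mul (is_derive_cst c2 s 1) (dw c s cr' s01).
    by apply: (is_derive_eq dc); rewrite mul0r add0r.
  have [e0 e1] := eq_itv0_derive ltr01 dl dr eqc; split=> [|s s01].
    by move: e0; rewrite /v /w !mulr0 !addr0 nnps_gen_at0.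
  by move: (e1 s s01); rewrite !mulrA.
have [|e0 /(step _ _ _ (cvg_disc_diffs ar) (cvg_disc_diffs ar'))] := step a C 1 ar ar'.
- move=> s s01; rewrite mul1r /C /v /w add0r.
  have -> : u + t * al * s = t * (1 - al + al * s) by rewrite /u; ring.
  by rewrite /C -mulrA [_^-1 * _]mulrC (thinning tT s01) mulrC divfK// gt_eqF.
move=> [e1 /(step _ _ _ (cvg_disc_diffs (cvg_disc_diffs ar))
  (cvg_disc_diffs (cvg_disc_diffs ar')))[e2 _]].
have d1 : pseries_diffs a 0 = a 1%N by rewrite /pseries_diffs mul1r.
have d2 : pseries_diffs (pseries_diffs a) 0 = 2 * a 2%N by rewrite /pseries_diffs mul1r.
rewrite d1 in e1; rewrite d2 in e2; case: (a_nnps) e0 => -> _ _ e0.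
have k0 : (C * (t * al)) ^+ 2 != 0 by rewrite sqrf_eq0 gt_eqF// mulr_gt0// mulr_gt0.
apply: (mulfI k0).
rewrite [LHS](_ : _ = (C * g u) * (C * (t * al) * (t * al) * g'' u) * a 1%N ^+ 2);
  last by ring.
rewrite [RHS](_ : _ = 2 * a 2%N * (C * (t * al) * g' u) ^+ 2); last by ring.
by rewrite e0 e1 e2; ring.
Qed.

(** By [thinning_ode2], (g / g')' = 1 - g g'' / g'^2 is a constant - gam on the
    interval [0, r0[, the points of which are the t (1 - al). *)
Lemma thinning_panjer : exists gam, panjer a gam.
Proof.
have [t tT] := nnps_param_nonempty a_nnps.
have [r tr ar] := nnps_param_disc tT.
have [t0 _] := tT; have /andP[al0 al1] := al01.
pose r0 := t * (1 - al).
pose gam := 2 * a 2%N / a 1%N ^+ 2 - 1.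
have r00 : 0 < r0 by rewrite mulr_gt0 ?subr_gt0.
have r0t : r0 < t by rewrite /r0; nra.
exists gam; apply: (@ode_panjer _ _ gam r0) => //.
  by move=> z zr; apply: ar; rewrite (lt_trans zr)// (lt_trans r0t).
move=> x /andP[x0 xr0].
have gp z : 0 <= z <= x -> 0 < g' z.
  by move=> /andP[z0 zx]; apply: (nnps_gen_diffs_gt0 a_nnps a1_gt0 ar); rewrite z0/=; lra.
have inr z : 0 <= z <= x -> `|z| < r by move=> /andP[z0 zx]; rewrite ger0_norm//; lra.
have := @derive0_eq _ (fun z => g z / g' z + (0 + gam * z)) 0 x (ltW x0) _.
rewrite !nnps_gen_at0 {2}/pseries_diffs mul1r; case: (a_nnps) => -> _ _.
rewrite mulr0 !addr0 add0r => e.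
have {e} : 1 / a 1%N = g x / g' x + gam * x.
  apply: e => z zx.
  have g'z := lt0r_neq0 (gp z zx).
  have d1 := is_derive1_div g'z (is_derive_nnps_gen ar (inr z zx))
     (is_derive_nnps_gen (cvg_disc_diffs ar) (inr z zx)).
  apply: (is_derive_eq (is_deriveD d1 (is_derive1_affine _ _ _))).
  have ode : g z * g'' z * a 1%N ^+ 2 = 2 * a 2%N * g' z ^+ 2.
    case/andP: zx; rewrite le_eqVlt => /predU1P[<- _|z0 zx].
      rewrite !nnps_gen_at0 /pseries_diffs; case: (a_nnps) => -> _ _; ring.
    have -> : z = z / (1 - al) * (1 - al) by rewrite divfK// gt_eqF// subr_gt0.
    apply: thinning_ode2; apply: (nnps_param_le tT).
    rewrite divr_gt0 ?subr_gt0//= ler_pdivrMr ?subr_gt0// -/r0.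
    by rewrite (le_trans zx)// ltW.
  have -> : g z * g'' z = 2 * a 2%N * g' z ^+ 2 / a 1%N ^+ 2.
    by rewrite -ode mulfK// sqrf_eq0 lt0r_neq0.
  by rewrite /gam; field; rewrite g'z lt0r_neq0.
move=> e.
have g'x : g' x != 0 by rewrite lt0r_neq0// gp// lexx ltW.
have -> : g x = (1 / a 1%N - gam * x) * g' x by rewrite e addrK divfK.
by field; rewrite lt0r_neq0.
Qed.

End thinning_to_panjer.

(** * The three families *)

Section families.
Context {R : realType}.
Variable a : nat -> R.
Hypothesis a_nnps : canonical_nnps a.
Hypothesis a1_gt0 : 0 < a 1%N.

Local Notation g := (nnps_gen a).

Let a0 : a 0%N = 1. Proof. by case: a_nnps. Qed.
Let a_ge0 k : 0 <= a k. Proof. by case: a_nnps. Qed.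

Let fact_neq0 k : k`!%:R != 0 :> R.
Proof. by rewrite pnatr_eq0 -lt0n fact_gt0. Qed.

Let natS_neq0 k : 1 + k%:R != 0 :> R.
Proof. by rewrite nat1r pnatr_eq0. Qed.

Lemma panjer_solution gam (A : nat -> R) : panjer a gam -> A 0%N = 1 ->
  (forall k, k.+1%:R * A k.+1 = a 1%N * (1 + gam * k%:R) * A k) -> a = A.
Proof.
move=> pa A0 recA; apply/funext; elim=> [|k IH]; first by rewrite a0 A0.
by apply: (@mulfI _ k.+1%:R); rewrite ?pnatr_eq0// pa recA IH.
Qed.

Lemma panjer_poisson : panjer a 0 -> poisson_family (nnps_param a) (nnps_pmf a).
Proof.
move=> pa t tT; have [t0 _] := tT.
have r0 : 0 < a 1%N * t by rewrite mulr_gt0.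
exists (a 1%N * t) => //; apply/funext => k.
have ak : a k = a 1%N ^+ k / k`!%:R.
  apply: (congr1 (@^~ k) (panjer_solution pa (A := fun k => a 1%N ^+ k / k`!%:R) _ _)).
    by rewrite expr0 fact0 divr1.
  move=> i; rewrite factS natrM exprS; field.
  by rewrite fact_neq0 natS_neq0.
have -> : nnps_pmf a t k = a k * t ^+ k / expR (a 1%N * t).
  rewrite /nnps_pmf; congr (_ / _).
  rewrite -[a 1%N * t]add0r.
  apply: (panjer_gen_unique a_nnps a1_gt0 (F := fun x => expR (0 + a 1%N * x))
     (F' := fun x => a 1%N * expR (0 + a 1%N * x)) pa tT).
  - by rewrite mulr0 addr0 expR0.
  - by move=> x _; rewrite gt_eqF// expR_gt0.
  - by move=> x _; apply: is_derive1_comp_affine; exact: is_derive_expR.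
  - by move=> x _; rewrite !mul0r subr0 mul1r.
by rewrite /poisson_pmf r0 ak expRN exprMn; ring.
Qed.

Lemma panjer_negative_binomial gam : 0 < gam -> panjer a gam ->
  negative_binomial_family (nnps_param a) (nnps_pmf a).
Proof.
move=> gam0 pa; exists gam^-1; first by rewrite invr_gt0.
move=> t tT; have [t0 _] := tT; have [r tr ar] := nnps_param_disc tT.
pose q := gam * a 1%N; have q0 : 0 < q by rewrite mulr_gt0.
have qt x : 0 <= x <= t -> 0 < 1 - q * x.
  move=> /andP[x0 xt]; apply: (panjer_coef_gt0 a_nnps a1_gt0 pa ar).
  by rewrite x0 (le_lt_trans xt).
have qt1 : 0 < 1 - q * t by apply: qt; rewrite lexx ltW.
exists (q * t); first by rewrite mulr_gt0//= -subr_gt0.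
apply/funext => k.
pose A k := \prod_(i < k) (gam^-1 + i%:R) / k`!%:R * q ^+ k.
have ak : a k = A k.
  apply: (congr1 (@^~ k) (panjer_solution pa (A := A) _ _)) => [|i].
    by rewrite /A big_ord0 expr0 fact0 mulr1 divr1.
  rewrite /A /q factS natrM exprS big_ord_recr/=; field.
  by rewrite fact_neq0 natS_neq0 gt_eqF.
have -> : nnps_pmf a t k = a k * t ^+ k / (1 - q * t) `^ (- gam^-1).
  rewrite /nnps_pmf; congr (_ / _).
  rewrite -mulNr.
  apply: (panjer_gen_unique a_nnps a1_gt0 (F := fun x => (1 + - q * x) `^ (- gam^-1))
     (F' := fun x => - q * (- gam^-1 * (1 + - q * x) `^ (- gam^-1 - 1))) pa tT).
  - by rewrite mulr0 addr0 powR1.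
  - by move=> x /qt qx; rewrite mulNr gt_eqF// powR_gt0.
  - move=> x /qt qx.
    apply: (@is_derive1_comp_affine _ (fun z => z `^ (- gam^-1)) 1 (- q) x).
    apply: is_derive1_powR.
    by rewrite mulNr.
  - move=> x /qt qx; rewrite -/q (mulNr q x).
    have -> : (1 - q * x) `^ (- gam^-1) = (1 - q * x) * (1 - q * x) `^ (- gam^-1 - 1).
      rewrite -{2}(powRr1 (ltW qx)) -powRD; last by rewrite (gt_eqF qx) implybT.
      by congr (_ `^ _); ring.
    by rewrite /q; field; rewrite gt_eqF.
by rewrite /negative_binomial_pmf powRN invrK ak /A (exprMn _ q t); ring.
Qed.

(** At the first n with 1 + gam n <= 0 the coefficients a_0, ..., a_n are positive,
    so a_(n+1) >= 0 leaves only 1 + gam n = 0. *)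
Lemma panjer_lt0_inv_nat gam : gam < 0 -> panjer a gam ->
  exists2 n, (1 <= n)%N & gam = - n%:R^-1.
Proof.
move=> gam0 pa.
have exP : exists n : nat, [pred n : nat | 1 + gam * n%:R <= 0] n.
  exists (Num.truncn (- gam^-1)).+1; rewrite inE/=.
  have := truncnS_gt (- gam^-1).
  by rewrite -(ltr_nM2l gam0) mulrN divff ?lt_eqF// => ?; lra.
case: (ex_minnP exP) => n /= Pn mmin.
have nmin k : (k < n)%N -> 0 < 1 + gam * k%:R.
  by rewrite ltNge; apply: contraL => /mmin; rewrite -leqNgt.
have a_gt0 k : (k <= n)%N -> 0 < a k.
  elim: k => [|k IH] kn; first by rewrite a0.
  by rewrite -(@pmulr_rgt0 _ k.+1%:R) ?ltr0n// pa !mulr_gt0 ?nmin ?IH// ltnW.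
exists n; first by rewrite lt0n; apply: contraTneq Pn => ->; rewrite mulr0 addr0 -ltNge.
have n1 : 0 < n%:R :> R.
  by rewrite ltr0n lt0n; apply: contraTneq Pn => ->; rewrite mulr0 addr0 -ltNge.
have : 0 <= a 1%N * (1 + gam * n%:R) * a n by rewrite -pa mulr_ge0.
rewrite pmulr_lge0 ?a_gt0// pmulr_rge0// => n0'.
have /eqP : 1 + gam * n%:R = 0 by apply/le_anti; rewrite Pn n0'.
rewrite addrC addr_eq0 => /eqP e; apply: (mulIf (lt0r_neq0 n1)).
by rewrite e mulNr mulVf ?gt_eqF.
Qed.

Lemma panjer_binomial n : (1 <= n)%N -> panjer a (- n%:R^-1) ->
  binomial_family (nnps_param a) (nnps_pmf a).
Proof.
move=> n1 pa; exists n => // t tT; have [t0 _] := tT.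
have n0 : 0 < n%:R :> R by rewrite ltr0n.
pose q := a 1%N / n%:R; have q0 : 0 < q by rewrite divr_gt0.
have D0 : 0 < 1 + q * t by rewrite addr_gt0// mulr_gt0.
exists (q * t / (1 + q * t)).
  by rewrite ltr_pdivrMr// mul1r ltrDr ltr01 andbT divr_gt0// mulr_gt0.
apply/funext => k.
pose A k := q ^+ k * 'C(n, k)%:R.
have ak : a k = A k.
  apply: (congr1 (@^~ k) (panjer_solution pa (A := A) _ _)) => [|i].
    by rewrite /A expr0 mul1r bin0.
  rewrite /A mulrCA -natrM mul_bin_left natrM exprS /q.
  have [ni|ni] := leqP i n; last by rewrite bin_small// !mulr0.
  by rewrite natrB//; field; rewrite gt_eqF.
have -> : nnps_pmf a t k = a k * t ^+ k / (1 + q * t) ^+ n.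
  rewrite /nnps_pmf; congr (_ / _).
  apply: (panjer_gen_unique a_nnps a1_gt0 (F := fun x => (1 + q * x) ^+ n)
     (F' := fun x => q * (n%:R * (1 + q * x) ^+ n.-1)) pa tT).
  - by rewrite mulr0 addr0 expr1n.
  - by move=> x /andP[x0 _]; rewrite gt_eqF// exprn_gt0// ltr_pwDl// mulr_ge0// ltW.
  - move=> x _; apply: (@is_derive1_comp_affine _ (fun z => z ^+ n)).
    by apply: DeriveDef; [exact: exprn_derivable|rewrite exp_derive /GRing.scale/= mulr1].
  - move=> x _; rewrite -[in RHS](prednK n1) exprS /q; field.
    by rewrite gt_eqF.
rewrite ak /A /binomial_pmf -[RHS]mulr_natr.
have [kn|kn] := leqP k n; last by rewrite bin_small// !(mulr0, mul0r).
have -> : unstable.onem (q * t / (1 + q * t)) = (1 + q * t)^-1.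
  by rewrite /unstable.onem; field; rewrite gt_eqF.
have -> : (1 + q * t) ^+ n = (1 + q * t) ^+ (n - k) * (1 + q * t) ^+ k.
  by rewrite -exprD subnK.
rewrite !exprMn !exprVn; move: (1 + q * t) D0 => D D0; field.
by rewrite !expf_neq0// gt_eqF.
Qed.

Lemma panjer_families gam : panjer a gam ->
  [\/ poisson_family (nnps_param a) (nnps_pmf a),
      negative_binomial_family (nnps_param a) (nnps_pmf a) |
      binomial_family (nnps_param a) (nnps_pmf a)].
Proof.
move=> pa; case: (ltrgt0P gam) => [gam0|gam0|gam0].
- by apply: Or32; exact: panjer_negative_binomial pa.
- by have [n n1 gamn] := panjer_lt0_inv_nat gam0 pa;
    apply: Or33; apply: panjer_binomial n1 _; rewrite -gamn.
- by apply: Or31; apply: panjer_poisson; rewrite -gam0.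
Qed.

(** One member of the family determines a: the factor t^k / g(t) only rescales
    the recursion, and its case k = 0 identifies x with a_1 t. *)
Lemma pmf_recursion_panjer t x y : nnps_param a t ->
  (forall k, k.+1%:R * nnps_pmf a t k.+1 = (x + y * k%:R) * nnps_pmf a t k) ->
  panjer a (y / x).
Proof.
move=> tT rec; have [t0 _] := tT; have [r tr ar] := nnps_param_disc tT.
have gt0 : 0 < g t by rewrite (lt_le_trans _ (nnps_gen_ge1 a_nnps ar _))// tr ltW.
have rec_a k : k.+1%:R * a k.+1 * t = (x + y * k%:R) * a k.
  have gt : g t / t ^+ k != 0 by rewrite mulf_neq0 ?invr_eq0 ?expf_neq0 ?gt_eqF.
  have := congr1 ( *%R^~ (g t / t ^+ k)) (rec k).
  rewrite /nnps_pmf exprS.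
  have tk : t ^+ k != 0 by rewrite expf_neq0 ?gt_eqF.
  have gn : g t != 0 by rewrite gt_eqF.
  rewrite [LHS](_ : _ = k.+1%:R * a k.+1 * t); last by field; rewrite gn tk.
  by rewrite [RHS](_ : _ = (x + y * k%:R) * a k)//; field; rewrite gn tk.
have xE : x = a 1%N * t by have := rec_a 0%N; rewrite a0 mulr0 addr0 mulr1 mul1r => ->.
move=> k; apply: (mulIf (lt0r_neq0 t0)); rewrite rec_a xE.
by field; rewrite !gt_eqF.
Qed.

Lemma families_panjer :
  [\/ poisson_family (nnps_param a) (nnps_pmf a),
      negative_binomial_family (nnps_param a) (nnps_pmf a) |
      binomial_family (nnps_param a) (nnps_pmf a)] -> exists gam, panjer a gam.
Proof.
have [t tT] := nnps_param_nonempty a_nnps.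
case=> [/(_ t tT)[rate rate0 pmfE]|[r r0 /(_ t tT)[p /andP[p0 p1] pmfE]]|
        [n n1 /(_ t tT)[p /andP[p0 p1] pmfE]]].
- exists (0 / rate); apply: (pmf_recursion_panjer tT) => k.
  rewrite pmfE /poisson_pmf rate0 factS natrM exprS; field.
  by rewrite fact_neq0 natS_neq0.
- exists (p / (r * p)); apply: (pmf_recursion_panjer tT) => k.
  rewrite pmfE /negative_binomial_pmf factS natrM exprS big_ord_recr/=; field.
  by rewrite fact_neq0 natS_neq0.
pose rho := p / (1 - p); have p1' : 0 < 1 - p by rewrite subr_gt0.
exists (- rho / (rho * n%:R)); apply: (pmf_recursion_panjer tT) => k.
have binE i : binomial_pmf n p i = p ^+ i * (1 - p) ^+ (n - i) * 'C(n, i)%:R.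
  by rewrite mulr_natr.
rewrite pmfE !binE mulrCA -natrM mul_bin_left natrM.
have [kn|kn|->] := ltngtP k n; last 2 first.
- by rewrite bin_small// !mulr0.
- by rewrite subnn mul0r mulr0 [_ + _](_ : _ = 0) ?mul0r//; ring.
rewrite natrB ?(ltnW kn)// -[(n - k)%N]prednK ?subn_gt0// -subnS !exprS /rho.
by field; rewrite gt_eqF.
Qed.

End families.

(** * Restricted stone throwing measures of a power series family *)

Lemma integral_probability_cst {d} {T : measurableType d} {R : realType}
  (P : probability T R) (c : R) : (\int[P]_x c%:E = c%:E)%E.
Proof.
rewrite (@integral_cst _ _ _ P setT measurableT c%:E).
by rewrite -[RHS]mule1 -(probability_setT P).
Qed.

Section nnps_stones.
Context {d dO} {E : measurableType d} {Om : measurableType dO} {R : realType}.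
Variables (a : nat -> R) (t : R) (nu : probability E R) (P : probability Om R).
Variables (K : {RV P >-> nat}) (X : nat -> {RV P >-> E}).
Hypothesis tT : nnps_param a t.
Hypothesis stc : stone_throwing (nnps_pmf a t) nu K X.

Local Notation g := (nnps_gen a).

Lemma nnps_stones_functional (y : E -> R) (m : R) :
  measurable_fun setT y -> (forall x, 0 <= y x) ->
  (\int[nu]_x (y x)%:E = m%:E)%E -> 0 <= m <= 1 ->
  ('E_P[fun w => (\prod_(i < K w) y (X i w))%R] = (g (t * m) / g t)%:E)%E.
Proof.
move=> my y0 ym /andP[m0 m1]; rewrite (stone_throwing_pgf stc my y0 ym).
have [r tr ar] := nnps_param_disc tT; have [t0 _] := tT.
have tmr : `|t * m| < r.
  by rewrite ger0_norm ?mulr_ge0 ?(ltW t0)// (le_lt_trans _ tr)// ler_piMr// ltW.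
have cvgE : (g t)^-1 * pseries a (t * m) n @[n --> \oo] --> g (t * m) / g t.
  by rewrite [X in _ --> X]mulrC; apply: cvgMr; exact: ar.
apply/cvg_lim => //.
rewrite (_ : (fun n => _) = EFin \o (fun n => (g t)^-1 * pseries a (t * m) n)).
  exact: (cvg_comp _ _ cvgE).
apply/funext => n /=; rewrite sumEFin /pseries /series/= mulr_sumr; congr EFin.
by apply: eq_bigr => i _; rewrite /nnps_pmf exprMn; ring.
Qed.

Lemma nnps_stones_pgf s : 0 <= s <= 1 -> pgf P K s = (g (t * s) / g t)%:E.
Proof.
move=> s01; rewrite -(@nnps_stones_functional (cst s))//.
- by congr expectation; apply/funext => w; rewrite prodr_const card_ord.
- by move=> x; case/andP: s01.
- exact: integral_probability_cst.
Qed.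

(** exp(- 1_A f) is e^{-f} on A and 1 off A. *)
Lemma integral_thinned (A : set E) (mA : measurable A) (al : R) (f : E -> R) :
  0 < al -> nu A = al%:E -> measurable_fun setT f -> (forall x, 0 <= f x) ->
  let s := \int[cond_prob nu mA]_x expR (- f x) in
  0 <= s <= 1 /\
  (\int[nu]_x (expR (- (\1_A x * f x)))%:E = (1 - al + al * s)%:E)%E.
Proof.
move=> al0 nuA mf f0 s.
have me : measurable_fun setT (fun x => expR (- f x)).
  by apply: measurableT_comp => //; exact: measurableT_comp.
have e0 x : 0 <= expR (- f x) by exact: expR_ge0.
have le1 : (\int[cond_prob nu mA]_x (expR (- f x))%:E <= 1%:E)%E.
  rewrite -(integral_probability_cst (cond_prob nu mA)).
  apply: ge0_le_integral => //=.
  - exact/measurable_EFinP.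
  - by move=> x _; rewrite lee_fin -expR0 ler_expR oppr_le0.
have sE : (\int[cond_prob nu mA]_x (expR (- f x))%:E = s%:E)%E.
  rewrite /s /Rintegral fineK// ge0_fin_numE; last first.
    by apply: integral_ge0 => x _; rewrite lee_fin.
  exact: le_lt_trans le1 (ltry _).
have s1 : s <= 1 by rewrite -lee_fin -sE.
have s0 : 0 <= s by apply: Rintegral_ge0.
split; first by rewrite s0.
have onA : (\int[nu]_x (\1_A x * expR (- f x))%:E = (al * s)%:E)%E.
  rewrite EFinM -sE; apply: (@ge0_integral_indic_extend _ _ _ _ _ nu (cond_prob nu mA) al
    \1_A id (fun x => expR (- f x))) => //.
  - exact: ltW.
  - move=> B mB; transitivity (\int[nu]_x (\1_(A `&` B) x)%:E)%E.
      by apply: eq_integral => x _; rewrite indicI.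
    rewrite integral_indic ?setIT//; last exact: measurableI.
    transitivity (al%:E * (nu (A `&` B) * (fine (nu A))^-1%:E))%E; last first.
      by congr (_ * _)%E; apply/esym/cond_probE; rewrite nuA lte_fin.
    by rewrite nuA/= muleCA -EFinM mulfV ?mule1// gt_eqF.
transitivity (\int[nu]_x ((\1_A x * expR (- f x))%:E + (\1_(~` A) x)%:E))%E.
  apply: eq_integral => x _; rewrite -EFinD; congr EFin; rewrite !indicE in_setC.
  by case: (x \in A); rewrite /= ?mul1r ?addr0// !mul0r oppr0 expR0 add0r.
have mAC : measurable_fun setT (\1_(~` A) : E -> R).
  by apply: measurable_indic; exact: measurableC.
have m1e : measurable_fun setT (fun x => (\1_A x * expR (- f x))%:E).
  by apply/measurable_EFinP/measurable_funM.
have mACE : measurable_fun setT (EFin \o (\1_(~` A) : E -> R)).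
  exact/measurable_EFinP.
rewrite ge0_integralD//=.
rewrite onA integral_indic ?setIT//; last exact: measurableC.
have nuAC : nu (~` A) = (1 - al)%:E.
  by have := probability_setC nu mA; rewrite nuA EFinB.
by rewrite [RHS]EFinD addeC; congr (_ + _)%E.
Qed.

Lemma nnps_stones_laplace (A : set E) (mA : measurable A) (al : R) (f : E -> R) :
  0 < al -> nu A = al%:E -> measurable_fun setT f -> (forall x, 0 <= f x) ->
  ('E_P[fun w => expR (- \int[mrestr (stone_measure K X w) mA]_x f x)] =
   (g (t * (1 - al + al * \int[cond_prob nu mA]_x expR (- f x))) / g t)%:E)%E.
Proof.
move=> al0 nuA mf f0; have [s01 inty] := integral_thinned mA al0 nuA mf f0.
have al1 : al <= 1 by rewrite -lee_fin -nuA probability_le1.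
rewrite -(nnps_stones_functional (y := fun x => expR (- (\1_A x * f x))) _ _ inty).
- congr expectation; apply/funext => w.
  by rewrite Rintegral_stone_measure// -sumrN expR_sum.
- apply: measurableT_comp => //; apply: measurableT_comp => //.
  by apply: measurable_funM => //; exact: measurable_indic.
- by move=> x; exact: expR_ge0.
- case/andP: s01 => s0 s1; rewrite addr_ge0 ?subr_ge0 ?mulr_ge0 ?(ltW al0)//=.
  by rewrite -[leRHS](subrK al) lerD2l ler_piMr// ltW.
Qed.

End nnps_stones.

Theorem theorem3 (R : realType) (a : nat -> R)
    (d : measure_display) (E : measurableType d) (nu : probability E R)
    (dO : R -> measure_display) (Om : forall t : R, measurableType (dO t))
    (P : forall t : R, probability (Om t) R)
    (K : forall t : R, {RV (P t) >-> nat})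
    (X : forall t : R, nat -> {RV (P t) >-> E}) :
  canonical_nnps a ->
  (forall t : R, nnps_param a t ->
     [set 0%N; 1%N] `<=` pmf_support (nnps_pmf a t)) ->
  nonatomic nu ->
  (forall t : R, nnps_param a t ->
     stone_throwing (nnps_pmf a t) nu (K t) (X t)) ->
  (forall alpha : R, 0 < alpha ->
     exists2 h : R -> R,
       (forall t : R, nnps_param a t -> nnps_param a (h t)) &
       forall (A : set E) (mA : measurable A), nu A = alpha%:E ->
       forall t : R, nnps_param a t ->
       forall f : E -> R, measurable_fun setT f -> (forall x : E, 0 <= f x) ->
         'E_(P t)[fun w =>
            expR (- \int[mrestr (stone_measure (K t) (X t) w) mA]_x f x)]%E =
         pgf (P (h t)) (K (h t)) (\int[cond_prob nu mA]_x expR (- f x)))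
  <->
  [\/ poisson_family (nnps_param a) (nnps_pmf a),
      negative_binomial_family (nnps_param a) (nnps_pmf a) |
      binomial_family (nnps_param a) (nnps_pmf a)].
Proof.
move=> a_nnps supp nu_diffuse stc.
have [t1 t1T] := nnps_param_nonempty a_nnps.
have a1_gt0 : 0 < a 1%N.
  have : 0 < nnps_pmf a t1 1 by apply: (supp t1 t1T); right.
  have a1_ge0 : 0 <= a 1%N by case: a_nnps.
  rewrite [in X in _ -> X]lt0r a1_ge0 andbT; apply: contraTneq => a10.
  by rewrite /nnps_pmf a10 !mul0r ltxx.
split=> [thin|fam].
  have nuT0 : (0 < nu setT)%E by rewrite probability_setT.
  have [B [mB _ /andP[nuB_gt0 nuB_lt]]] := nu_diffuse setT measurableT nuT0.
  have {nuB_gt0} B0 : (0 < nu B)%E := nuB_gt0.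
  have {nuB_lt} B1 : (nu B < nu setT)%E := nuB_lt.
  rewrite probability_setT in B1.
  have nuB : nu B = (fine (nu B))%:E by rewrite fineK// fin_num_measure.
  set al := fine (nu B) in nuB.
  rewrite nuB !lte_fin in B0 B1.
  have [h hT thin_h] := thin al B0.
  have [gam pa] : exists gam, panjer a gam.
    apply: (@thinning_panjer _ _ a_nnps a1_gt0 al h) => // [|t s tT /andP[s0 s1]].
      by rewrite B0.
    (* a constant f = - ln s already realises every s in ]0, 1[ *)
    have f0 (x : E) : 0 <= (cst (- ln s) : E -> R) x by rewrite oppr_ge0 ln_le0// ltW.
    have := thin_h B mB nuB t tT (cst (- ln s)) (measurable_cst _) f0.
    rewrite (nnps_stones_laplace tT (stc t tT) mB B0 nuB (measurable_cst _) f0).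
    have -> : \int[cond_prob nu mB]_x expR (- cst (- ln s) x) = s.
      rewrite /Rintegral (eq_integral (fun=> s%:E)) ?integral_probability_cst//.
      by move=> x _; rewrite /= opprK lnK.
    rewrite (nnps_stones_pgf (hT t tT) (stc _ (hT t tT))) ?(ltW s0) ?(ltW s1)//.
    by case.
  exact: panjer_families pa.
have [gam pa] := families_panjer a_nnps a1_gt0 fam.
move=> al al0; have [al1|al1] := leP al 1; last first.
  (* no set has measure al > 1, so any map of the parameter set will do *)
  exists id => // A mA nuA; have := probability_le1 nu mA.
  by rewrite nuA lee_fin leNgt al1.
have [|h hT thinning] := panjer_thinning a_nnps a1_gt0 pa (al := al); first by rewrite al0.
exists h => // A mA nuA t tT f mf f0.
rewrite (nnps_stones_laplace tT (stc t tT) mA al0 nuA mf f0).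
have [s01 _] := integral_thinned mA al0 nuA mf f0.
by rewrite (nnps_stones_pgf (hT t tT) (stc _ (hT t tT)) s01) thinning.
Qed.
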